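(* Let $k\geq 2$ be an integer and let $M=x_0^{a_0}x_1^{a_1}\in\mathbb{C}[x_0,x_1]$ be a monomial of degree $kd$. Then $$\#_k(M)\leq\max\{[a_0]_k,[a_1]_k\}+1.$$
   Context: For an integer $a\geq 0$, $[a]_k\in\{0,\ldots,k-1\}$ denotes the remainder of $a$ modulo $k$. Exponents of monomials are non-negative integers. A form of degree $d$ is a homogeneous polynomial of degree $d$ with complex coefficients (forms of degree $0$ are constants). For an integer $k\geq 2$ and a form $F\in\mathbb{C}[x_0,x_1]$ of degree $kd$, the $k^{th}$-Waring rank of $F$ is $\#_k(F):=\min\{s \mid F=g_1^k+\cdots+g_s^k \text{ for some forms } g_1,\ldots,g_s\in\mathbb{C}[x_0,x_1] \text{ of degree } d\}$. *)

(* Defs.v *)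
From mathcomp Require Import all_boot all_algebra.
From mathcomp Require Import mpoly.

Set Implicit Arguments.
Unset Strict Implicit.
Unset Printing Implicit Defensive.

Import GRing.Theory.
Local Open Scope ring_scope.

Definition waring_decomposable (C : comNzRingType) (k d : nat)
    (F : {mpoly C[2]}) (s : nat) : Prop :=
  exists2 g : 'I_s -> {mpoly C[2]},
    forall i, g i \is d.-homog & F = \sum_(i < s) g i ^+ k.

(* The k-th Waring rank of F, a form of degree k * d, as a relation
   "#_k(F) exists and equals r": asserting it includes that the set of
   admissible lengths is nonempty, so no junk value is needed.  The parameter d
   is explicit because deg F is not determined when F = 0.  The zero polynomial
   counts as a form of every degree; zero summands do not affect the minimum. *)
Definition is_waring_rank (C : comNzRingType) (k d : nat)
    (F : {mpoly C[2]}) (r : nat) : Prop :=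
  waring_decomposable k d F r /\
  forall s, waring_decomposable k d F s -> (r <= s)%N.

(* Main.v *)
Require Import Defs.
From HB Require Import structures.
From mathcomp Require Import all_boot all_order all_algebra.
From mathcomp Require Import reals complex mpoly.
From mathcomp Require Import boolp zify.
From mathcomp Require Import cyclic separable cyclotomic.

Set Implicit Arguments.
Unset Strict Implicit.
Unset Printing Implicit Defensive.

Import GRing.Theory Num.Theory.
Local Open Scope ring_scope.

(** Write [a0 = q0 * k + b0] and [a1 = q1 * k + b1] with remainders [b0], [b1].
    The monomial is the [k]-th power [(x0 ^ q0 * x1 ^ q1) ^ k] times
    [x0 ^ b0 * x1 ^ b1], so a decomposition of the second factor yields one of
    the monomial with as many summands ([waringMX]).  As [k] divides
    [b0 + b1 < 2 * k], either both remainders vanish and one power suffices, or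
    [b0 + b1 = k] and it remains to write [x0 ^ b0 * x1 ^ b1] as a sum of
    [n = max (b0, b1) + 1] powers of linear forms ([waring_monomial]).

    For that, take a primitive [n]-th root of unity [z] and average the powers
    [(x0 + z ^ j * x1) ^ k] over [j < n] against the character
    [z ^ (- j * b1)].  By orthogonality of characters only the terms
    [x0 ^ (k - i) * x1 ^ i] with [i] congruent to [b1] modulo [n] survive.
    Since [0 <= i <= k], the difference [i - b1] lies between [- b1] and [b0],
    hence is smaller than [n] in absolute value: only [i = b1] survives
    ([prim_root_average]).  The scalar coefficients of the resulting
    combination of powers are absorbed by extracting their [k]-th roots
    ([waring_sumZ]). *)

(** Orthogonality of the characters of the cyclic group of order [n]. *)
Lemma sum_prim_root_expr (F : fieldType) (n : nat) (z : F) (t : nat) :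
  n.-primitive_root z ->
  \sum_(j < n) (z ^+ t) ^+ j = if (n %| t)%N then n%:R else 0.
Proof.
move=> prim_z; case: ifPn => [|n'dvd_t].
  rewrite (prim_order_dvd prim_z) => /eqP->.
  by under eq_bigr do rewrite expr1n; rewrite sumr_const card_ord.
have zt_neq1 : z ^+ t - 1 != 0 by rewrite subr_eq0 -(prim_order_dvd prim_z).
apply: (mulfI zt_neq1); rewrite -subrX1 mulr0 exprAC.
by rewrite (prim_expr_order prim_z) expr1n subrr.
Qed.

(** The average over the [n]-th roots of unity isolates one term of the binomial
    expansion: the two strict bounds on [c] and [k - c] say that no exponent
    other than [c] in [0, k] is congruent to [c] modulo [n].  The exponent
    [j * (n - c)] stands for [- j * c], which is the same modulo [n]. *)
Lemma prim_root_average (F : fieldType) (A : comAlgType F) (n k c : nat)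
    (z : F) (x y : A) :
  n.-primitive_root z -> (c <= k)%N -> (c < n)%N -> (k - c < n)%N ->
  \sum_(j < n) z ^+ (j * (n - c)) *: (x + z ^+ j *: y) ^+ k =
    (n%:R * 'C(k, c)%:R) *: (x ^+ (k - c) * y ^+ c).
Proof.
move=> prim_z le_ck lt_cn lt_kcn.
have expand (j : 'I_n) : z ^+ (j * (n - c)) *: (x + z ^+ j *: y) ^+ k =
    \sum_(i < k.+1) ((z ^+ (i + (n - c))) ^+ j * 'C(k, i)%:R)
                      *: (x ^+ (k - i) * y ^+ i).
  rewrite exprDn scaler_sumr; apply: eq_bigr => i _.
  rewrite exprZn -scalerAr -scaler_nat !scalerA; congr (_ *: _).
  by rewrite mulrAC -!exprM -exprD -mulnDr mulnC addnC.
under eq_bigr do rewrite expand.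
rewrite exchange_big /=.
have term (i : 'I_k.+1) :
    \sum_(j < n) ((z ^+ (i + (n - c))) ^+ j * 'C(k, i)%:R)
                   *: (x ^+ (k - i) * y ^+ i) =
    if i == c :> nat then (n%:R * 'C(k, c)%:R) *: (x ^+ (k - c) * y ^+ c)
    else 0.
  rewrite -scaler_suml -mulr_suml sum_prim_root_expr //.
  have -> : (n %| i + (n - c))%N = (i == c :> nat).
    (* The multiple q * n equals i + (n - c), which lies strictly between 0 and
       2 * n, so q = 1. *)
    apply/dvdnP/eqP => [[q q_eq]|->]; last by exists 1%N; lia.
    have := ltn_ord i => lt_ik.
    case: q q_eq => [|[|q]] q_eq; [lia|lia|].
    have : (n.*2 <= q.+2 * n)%N by rewrite -mul2n leq_mul2r orbT.
    lia.
  by case: eqP => [->|_] //; rewrite mul0r scale0r.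
under eq_bigr do rewrite term.
rewrite -big_mkcond /= (big_pred1 (Ordinal (le_ck : c < k.+1)%N)) //.
Qed.

(** When [n] is invertible, ['X^n - 1] is separable, so it has [n] distinct roots
    in a closed field, and a group of [n] roots of unity is cyclic. *)
Lemma closed_prim_root_exists (F : closedFieldType) (n : nat) :
  n%:R != 0 :> F -> exists z : F, n.-primitive_root z.
Proof.
move=> n_neq0; have n_gt0 : (0 < n)%N by case: n n_neq0; rewrite ?eqxx.
have [r Xn1_eq] := closed_field_poly_normal ('X^n - 1 : {poly F}).
rewrite (monicP _) ?monicXnsubC // scale1r in Xn1_eq.
have r_roots : all n.-unity_root r.
  by apply/allP=> z; rewrite -root_prod_XsubC -Xn1_eq.
have r_uniq : uniq r.
  by rewrite -separable_prod_XsubC -Xn1_eq separable_Xn_sub_1.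
have size_r : (n <= size r)%N.
  by rewrite -ltnS -(size_prod_XsubC r id) -Xn1_eq size_XnsubC.
by have /hasP[z _ prim_z] := has_prim_root n_gt0 r_roots r_uniq size_r; exists z.
Qed.

(** Over a closed field a linear combination of [k]-th powers is a plain sum of
    [k]-th powers, by moving a [k]-th root of each coefficient into its form. *)
Lemma waring_sumZ (C : numClosedFieldType) (k d s : nat)
    (c : 'I_s -> C) (g : 'I_s -> {mpoly C[2]}) :
  (0 < k)%N -> (forall i, g i \is d.-homog) ->
  waring_decomposable k d (\sum_(i < s) c i *: g i ^+ k) s.
Proof.
move=> k_gt0 g_homog; exists (fun i => k.-root (c i) *: g i) => [i|].
  exact: dhomogZ.
by apply: eq_bigr => i _; rewrite exprZn rootCK.
Qed.

Lemma waringMX (C : comNzRingType) (k d e s : nat) (h F : {mpoly C[2]}) :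
  h \is e.-homog -> waring_decomposable k d F s ->
  waring_decomposable k (e + d) (h ^+ k * F) s.
Proof.
move=> h_homog [g g_homog ->]; exists (fun i => h * g i) => [i|].
  exact: dhomogM.
by rewrite mulr_sumr; apply: eq_bigr => i _; rewrite exprMn.
Qed.

Lemma dhomog_var (C : comNzRingType) (i : 'I_2) :
  'X_i \is [in C[2], 1.-homog].
Proof. by rewrite dhomogX /= mdeg1. Qed.

Lemma dhomog_monomial (C : comNzRingType) (a b : nat) :
  'X_(0 : 'I_2) ^+ a * 'X_(1 : 'I_2) ^+ b \is [in C[2], (a + b).-homog].
Proof.
by apply: dhomogM; rewrite -[X in X.-homog]mul1n; apply: dhomogMn;
  apply: dhomog_var.
Qed.

(** The classical bound for the Waring rank of a binary monomial, by linear
    forms: [n = max (b, c) + 1] is the least number of roots of unity for which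
    the averaging isolates the exponent [c] in both directions. *)
Lemma waring_monomial (C : numClosedFieldType) (b c : nat) :
  (0 < b + c)%N ->
  waring_decomposable (b + c) 1
    ('X_(0 : 'I_2) ^+ b * 'X_(1 : 'I_2) ^+ c : {mpoly C[2]}) (maxn b c + 1).
Proof.
move=> bc_gt0; set n := (maxn b c + 1)%N.
have n_neq0 : n%:R != 0 :> C by rewrite pnatr_eq0 /n addn1.
have [z prim_z] := closed_prim_root_exists n_neq0.
pose w : C := n%:R * 'C(b + c, c)%:R.
have w_neq0 : w != 0.
  by rewrite mulf_neq0 // pnatr_eq0 -lt0n bin_gt0 leq_addl.
have average := @prim_root_average _ {mpoly C[2]} n (b + c) c z
                  'X_(0 : 'I_2) 'X_(1 : 'I_2) prim_z.
rewrite addnK in average.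
have -> : 'X_(0 : 'I_2) ^+ b * 'X_(1 : 'I_2) ^+ c = \sum_(j < n)
    (w^-1 * z ^+ (j * (n - c))) *: ('X_0 + z ^+ j *: 'X_1) ^+ (b + c)
    :> {mpoly C[2]}.
  under eq_bigr do rewrite -scalerA.
  by rewrite -scaler_sumr average ?scalerK // ?leq_addl /n; lia.
apply: waring_sumZ => // j.
by apply: dhomogD; [|apply: dhomogZ]; apply: dhomog_var.
Qed.

(** A nonempty set of admissible lengths has a minimum, by the well-ordering of
    [nat]; as admissibility is not decidable, the argument is classical. *)
Lemma waring_rank_exists (C : comNzRingType) (k d s : nat) (F : {mpoly C[2]}) :
  waring_decomposable k d F s ->
  exists2 r, is_waring_rank k d F r & (r <= s)%N.
Proof.
move=> F_s; have ex_len : exists s, `[< waring_decomposable k d F s >].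
  by exists s; apply/asboolP.
case: (ex_minnP ex_len) => r /asboolP F_r r_min.
exists r; last by apply: r_min; apply/asboolP.
by split=> // t F_t; apply: r_min; apply/asboolP.
Qed.

Theorem proposition3p4 (R : realType) (k d a0 a1 : nat)
    (hk : (2 <= k)%N) (hdeg : (a0 + a1 = k * d)%N) :
  exists2 r : nat,
    is_waring_rank k d
      ('X_(0 : 'I_2) ^+ a0 * 'X_(1 : 'I_2) ^+ a1 : {mpoly R[i][2]}) r
    & (r <= maxn (a0 %% k) (a1 %% k) + 1)%N.
Proof.
apply: waring_rank_exists.
have k_gt0 : (0 < k)%N by lia.
set b0 := (a0 %% k)%N; set b1 := (a1 %% k)%N.
set q0 := (a0 %/ k)%N; set q1 := (a1 %/ k)%N.
have a0_eq : a0 = (q0 * k + b0)%N := divn_eq a0 k.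
have a1_eq : a1 = (q1 * k + b1)%N := divn_eq a1 k.
have b0_lt : (b0 < k)%N := ltn_pmod a0 k_gt0.
have b1_lt : (b1 < k)%N := ltn_pmod a1 k_gt0.
have -> : 'X_(0 : 'I_2) ^+ a0 * 'X_(1 : 'I_2) ^+ a1 =
    ('X_0 ^+ q0 * 'X_1 ^+ q1) ^+ k * ('X_0 ^+ b0 * 'X_1 ^+ b1)
    :> {mpoly R[i][2]}.
  by rewrite a0_eq a1_eq !exprD !exprM exprMn mulrACA.
have h_homog := dhomog_monomial R[i] q0 q1.
have residue_sum : exists q, (b0 + b1 = k * q)%N.
  by exists (d - (q0 + q1))%N; nia.
(* Both remainders are below k, so their sum is 0 or k. *)
case: residue_sum => -[|[|q]] residue_sum.
- (* The bound is 1 here: the remaining factor is the constant form 1. *)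
  have -> : d = (q0 + q1 + 0)%N by nia.
  have [-> ->] : b0 = 0%N /\ b1 = 0%N by lia.
  apply: waringMX => //.
  exists (fun=> 1) => [i|]; first exact: dhomog1.
  by rewrite big_ord1 expr1n mulr1.
- have -> : d = (q0 + q1 + 1)%N by nia.
  apply: waringMX => //; rewrite muln1 in residue_sum.
  by rewrite -residue_sum; apply: waring_monomial; rewrite residue_sum.
- nia.
Qed.
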